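(* Fix an imprecise probability tree $(\overline{\mathrm Q}_s)_{s\in\mathscr X^\ast}$ with corresponding global upper expectation $\overline{\mathrm E}_{\mathrm V}$. For any situation $s\in\mathscr X^\ast$ and any $f\in\overline{\mathbb V}_{b,\mathrm{lim}}$, there is a sequence $\{f_n\}_{n\in\mathbb N_0}$ of gambles on $\Omega$, with $f_n$ being $n$-measurable for every $n\in\mathbb N_0$, that is uniformly bounded below and converges point-wise to $f$, for which $$\lim_{n\to+\infty}\overline{\mathrm E}_{\mathrm V}(f_n\vert s)=\overline{\mathrm E}_{\mathrm V}(f\vert s)$$ and $f_n\le\sup f$ for all $n\in\mathbb N_0$. If $\inf f\in\mathbb R$, then the sequence can moreover be chosen such that also $\inf f\le f_n$ for all $n\in\mathbb N_0$.
   Context: $\overline{\mathbb R}=\mathbb R\cup\{+\infty,-\infty\}$, $\mathbb N=\{1,2,\dots\}$, $\mathbb N_0=\mathbb N\cup\{0\}$. Conventions: $+\infty-\infty=-\infty+\infty=+\infty$, $0\cdot(\pm\infty)=0$, otherwise the usual arithmetic on $\overline{\mathbb R}$. For a non-empty set $\mathscr Y$, a gamble on $\mathscr Y$ is a bounded real-valued map on $\mathscr Y$, and $\overline{\mathscr L}_b(\mathscr Y)$ is the set of all maps $f\colon\mathscr Y\to\overline{\mathbb R}$ that are bounded below (there is $M\in\mathbb R$ with $f\ge M$). A sequence of maps is uniformly bounded below if a single $M\in\mathbb R$ is a lower bound for all of them. An upper expectation on $\overline{\mathscr L}_b(\mathscr Y)$ is a map $\overline{\mathrm E}\colon\overline{\mathscr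 L}_b(\mathscr Y)\to\overline{\mathbb R}$ such that: (E1) $\overline{\mathrm E}(c)=c$ for all constants $c\in\mathbb R$; (E2) $\overline{\mathrm E}(f+g)\le\overline{\mathrm E}(f)+\overline{\mathrm E}(g)$ for all $f,g$; (E3) $\overline{\mathrm E}(\lambda f)=\lambda\overline{\mathrm E}(f)$ for all $\lambda\in(0,+\infty)\cup\{+\infty\}$ and all non-negative $f$; (E4) $f\le g$ implies $\overline{\mathrm E}(f)\le\overline{\mathrm E}(g)$. $\mathscr X$ is a fixed non-empty finite set (state space). A situation is a finite string $x_{1:n}=(x_1,\dots,x_n)\in\mathscr X^n$, $n\in\mathbb N_0$ (the empty string is denoted $\Box$); $\mathscr X^\ast$ is the set of all situations; $sx$ is the string $s$ followed by $x\in\mathscr X$. $\Omega=\mathscr X^{\mathbb N}$ is the set of paths; for $\omega\in\Omega$, $\omega^n$ is the string of its first $n$ entries. $\Gamma(s)$ is the set of all paths that start with the string $s$. $\overline{\mathbb V}$ is the set of all maps $\Omega\to\overline{\mathbb R}$. For $f,g\in\overline{\mathbb V}$, $f\ge_s g$ means $f(\omega)\ge g(\omega)$ for all $\omega\in\Gamma(s)$. $\sup f$ and $\inf f$ are taken over $\Omega$. A map $f$ on $\Omega$ is $n$-measurable if it is constant on $\Gamma(x_{1:n})$ for every $x_{1:n}\in\mathscr X^n$, and finitary if it is $n$-measurable for some $n\in\mathbb N_0$. $\overline{\mathbb V}_{b,\mathrm{lim}}$ is the set of all bounded below $f\in\overline{\mathbb V}$ that are the point-wise limit of some sequence of finitary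 maps $\Omega\to\overline{\mathbb R}$. An imprecise probability tree assigns to every $s\in\mathscr X^\ast$ an upper expectation $\overline{\mathrm Q}_s$ on $\overline{\mathscr L}_b(\mathscr X)$. A supermartingale (for the given tree) is a map $\mathscr M\colon\mathscr X^\ast\to\overline{\mathbb R}$ that is bounded below by a real constant and satisfies $\overline{\mathrm Q}_s(\mathscr M(s\,\cdot))\le\mathscr M(s)$ for all $s\in\mathscr X^\ast$, where $\mathscr M(s\,\cdot)(x)=\mathscr M(sx)$. $\overline{\mathbb M}_{\mathrm b}$ is the set of all supermartingales, and $\liminf\mathscr M(\omega):=\liminf_{n\to+\infty}\mathscr M(\omega^n)$. The global upper expectation is, for $f\in\overline{\mathbb V}$ and $s\in\mathscr X^\ast$, $$\overline{\mathrm E}_{\mathrm V}(f\vert s):=\inf\{\mathscr M(s)\colon\mathscr M\in\overline{\mathbb M}_{\mathrm b}\text{ and }\liminf\mathscr M\ge_s f\}.$$ *)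

(* Defs.v *)
From mathcomp Require Import all_boot all_order all_algebra.
From mathcomp Require Import all_classical all_reals all_analysis.

Set Implicit Arguments.
Unset Strict Implicit.
Unset Printing Implicit Defensive.

Import Order.TTheory GRing.Theory Num.Theory.
Import numFieldNormedType.Exports.

Local Open Scope classical_set_scope.
Local Open Scope ereal_scope.

Section UpperExpectations.
Variables (R : realType) (Y : Type).

Definition bounded_below (f : Y -> \bar R) : Prop :=
  exists M : R, forall y, M%:E <= f y.

(* The domain of an upper expectation is the set of bounded below maps: [E] is
   a total function, but its values outside that set are unconstrained. The
   sums are the dual additions of [\bar R], for which +oo - oo = +oo; scaling
   is [mule], for which 0 * +oo = 0. *)
Record upper_expectation (E : (Y -> \bar R) -> \bar R) : Prop := {
  upper_cst : forall c : R, E (fun=> c%:E) = c%:E ;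
  upper_subadditive : forall f g : Y -> \bar R,
    bounded_below f -> bounded_below g ->
    E (fun y => (f y + g y)%dE) <= (E f + E g)%dE ;
  upper_homogeneous : forall (l : \bar R) (f : Y -> \bar R),
    0 < l -> bounded_below f -> (forall y, 0 <= f y) ->
    E (fun y => l * f y) = l * E f ;
  upper_monotone : forall f g : Y -> \bar R,
    bounded_below f -> bounded_below g -> (forall y, f y <= g y) ->
    E f <= E g
}.

End UpperExpectations.

Section Trees.
Variables (R : realType) (X : finType).

Definition situation := seq X.

(* The state at time k >= 1 of a path [w] is [w k.-1]. *)
Definition sample_path := nat -> X.

Definition initial (w : sample_path) (n : nat) : situation := mkseq w n.

Definition cylinder (s : situation) : set sample_path :=
  [set w | initial w (size s) = s].

Definition nmeasurable (n : nat) (f : sample_path -> \bar R) : Prop :=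
  forall s : situation, size s = n ->
  forall w w', cylinder s w -> cylinder s w' -> f w = f w'.

Definition finitary (f : sample_path -> \bar R) : Prop :=
  exists n, nmeasurable n f.

Definition Vblim : set (sample_path -> \bar R) :=
  [set f | bounded_below f /\
    exists g : nat -> sample_path -> \bar R,
      (forall n, finitary (g n)) /\ (forall w, g ^~ w @ \oo --> f w)].

Definition probability_tree (Q : situation -> (X -> \bar R) -> \bar R) : Prop :=
  forall s, upper_expectation (Q s).

Definition supermartingale (Q : situation -> (X -> \bar R) -> \bar R)
    (M : situation -> \bar R) : Prop :=
  bounded_below M /\ forall s, Q s (fun x => M (rcons s x)) <= M s.

Definition liminf_along (M : situation -> \bar R) (w : sample_path) : \bar R :=
  limn_einf (fun n => M (initial w n)).

Definition global_upper (Q : situation -> (X -> \bar R) -> \bar R)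
    (f : sample_path -> \bar R) (s : situation) : \bar R :=
  ereal_inf [set M s | M in
    [set M | supermartingale Q M /\
      forall w, cylinder s w -> f w <= liminf_along M w]].

End Trees.

(* Main.v *)
(* The main point is Fatou's lemma for the global upper expectation E_V.  It
   follows from Levy's zero-one law: if h is bounded below, then outside a null
   set the supermartingale E_V(h|.) has limit inferior at least h; adding a small
   nonnegative supermartingale that tends to +oo on the null set makes this hold
   everywhere.

   Write f as the limit of n-measurable gambles G_n, truncated to lie between
   inf f (when it is finite) and sup f.  Given k, take a supermartingale M with
   M(s) <= E_V(f|s) + 1/k and liminf M > f where f is finite.  Every path has a
   time at which M dominates some G_j with k <= j; since the state space is
   finite, the first such time is bounded, so the corresponding G_j form a
   finitary gamble f_k, and stopping M shows E_V(f_k|s) <= E_V(f|s) + 1/k.  As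
   f_k takes its values among the G_j with k <= j, it converges to f, and Fatou's
   lemma gives the reverse inequality in the limit.  Finally the f_k are repeated
   often enough to make the n-th gamble n-measurable. *)

Require Import Defs.
From mathcomp Require Import all_boot all_order all_algebra.
From mathcomp Require Import all_classical all_reals all_analysis.
From mathcomp Require Import lra.
Import Order.TTheory GRing.Theory Num.Theory.
Import numFieldNormedType.Exports.
Local Open Scope classical_set_scope.
Local Open Scope ereal_scope.

Set Implicit Arguments.
Unset Strict Implicit.
Unset Printing Implicit Defensive.

(** * Order characterizations of the limit inferior in the extended reals *)

Section LimitInferior.
Variable R : realType.
Implicit Types u v : nat -> \bar R.

Lemma limn_einf_sup_einfs u : limn_einf u = ereal_sup (range (einfs u)).
Proof. by rewrite limn_einf_lim; apply/cvg_lim => //; exact: cvg_einfs_sup. Qed.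

Lemma limn_einf_ge u c N : (forall n, (N <= n)%N -> c <= u n) ->
  c <= limn_einf u.
Proof.
move=> cu; rewrite limn_einf_sup_einfs.
apply: (@le_trans _ _ (einfs u N)); last by apply: ereal_sup_ubound; exists N.
by apply: le_ereal_inf_tmp => _ [n /= Nn <-]; exact: cu.
Qed.

Lemma limn_einf_gt u c : c < limn_einf u ->
  exists N, forall n, (N <= n)%N -> c < u n.
Proof.
rewrite limn_einf_sup_einfs => /ereal_sup_gt [_ [N _ <-] cN].
exists N => n Nn; apply: (lt_le_trans cN).
by apply: ereal_inf_lbound; exists n.
Qed.

Lemma limn_einf_lt u c N : limn_einf u < c -> exists2 n, (N <= n)%N & u n < c.
Proof.
move=> uc; apply: contrapT => H.
have : c <= limn_einf u.
  apply: (@limn_einf_ge _ _ N) => n Nn; rewrite leNgt; apply/negP => unc.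
  by apply: H; exists n.
by rewrite leNgt uc.
Qed.

Lemma le_limn_einf u v N : (forall n, (N <= n)%N -> u n <= v n) ->
  limn_einf u <= limn_einf v.
Proof.
move=> uv; rewrite leNgt; apply/negP => vu.
suff : exists c, limn_einf v < c /\ exists N', forall n, (N' <= n)%N -> c <= u n.
  case=> c [vc [N' cu]]; have := vc; rewrite ltNge => /negP; apply.
  apply: (@limn_einf_ge _ _ (maxn N N')) => n; rewrite geq_max => /andP[Nn N'n].
  exact: le_trans (cu _ N'n) (uv _ Nn).
move: vu; rewrite (limn_einf_sup_einfs u) => /ereal_sup_gt [_ [N' _ <-] cN].
exists (einfs u N'); split => //; exists N' => n Nn.
by apply: ereal_inf_lbound; exists n.
Qed.

Lemma limn_einf_eq u v N : (forall n, (N <= n)%N -> u n = v n) ->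
  limn_einf u = limn_einf v.
Proof.
move=> uv; apply/eqP; rewrite eq_le; apply/andP; split;
  by apply: (@le_limn_einf _ _ N) => n /uv ->.
Qed.

Lemma limn_einf_cst (c : \bar R) : limn_einf (fun=> c) = c.
Proof. by have [->] := cvg_limn_einf_sup (@cvg_cst _ c nat \oo _). Qed.

End LimitInferior.

(** * Upper expectations on a finite set and their continuity from below *)

Lemma bounded_belowD (R : realType) (Y : Type) (f g : Y -> \bar R) :
  bounded_below f -> bounded_below g ->
  bounded_below (fun y => f y + g y).
Proof.
by move=> [a af] [b bg]; exists (a + b)%R => y; rewrite EFinD leeD.
Qed.

Section LocalModel.
Variables (R : realType) (Y : finType) (E : (Y -> \bar R) -> \bar R).
Hypothesis HE : upper_expectation E.
Implicit Types f g : Y -> \bar R.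

Lemma upper_ge (B : R) f : (forall y, B%:E <= f y) -> B%:E <= E f.
Proof.
move=> Bf; rewrite -(upper_cst HE B); apply: (upper_monotone HE) => //.
- by exists B.
- by exists B.
Qed.

Lemma upper_gtNy f : bounded_below f -> -oo < E f.
Proof. by case=> B Bf; apply: lt_le_trans (upper_ge Bf); exact: ltNyr. Qed.

Lemma upper_le_cst f (c : \bar R) : bounded_below f -> -oo < c ->
  (forall y, f y <= c) -> E f <= c.
Proof.
case: c => [c| |] // bf _ fc; last exact: leey.
by rewrite -(upper_cst HE c); apply: (upper_monotone HE) => //; exists c.
Qed.

(** Bounded below maps and their upper expectations avoid [-oo], and there the dual addition of the
    axiom agrees with the ordinary one. *)
Lemma upperD f g : bounded_below f -> bounded_below g ->
  E (fun y => f y + g y) <= E f + E g.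
Proof.
move=> bf bg.
have ad (x y : \bar R) : -oo < x -> -oo < y -> (x + y)%dE = x + y.
  by case: x y => [x| |] [y| |].
rewrite -ad ?upper_gtNy//.
have -> : (fun y => f y + g y) = (fun y => (f y + g y)%dE).
  apply/funext => y; rewrite ad//.
    by case: bf => B Bf; apply: lt_le_trans (Bf y); exact: ltNyr.
  by case: bg => B Bg; apply: lt_le_trans (Bg y); exact: ltNyr.
exact: upper_subadditive.
Qed.

Lemma finite_threshold (P : Y -> nat -> Prop) :
  (forall y, exists N, forall n, (N <= n)%N -> P y n) ->
  exists N, forall y n, (N <= n)%N -> P y n.
Proof.
move=> /choice [N HN]; exists (\max_y N y) => y n Hn; apply: HN.
by apply: leq_trans Hn; exact: leq_bigmax.
Qed.

(* On the set [A] where the limit is infinite, [E] of the indicator of [A] is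
   zero unless [E (g n)] is unbounded, and homogeneity for the factor [+oo]
   then makes the contribution of [A] vanish. *)
Lemma upper_sup_nondecreasing (B : R) (g : nat -> Y -> \bar R) :
  (forall n y, B%:E <= g n y) -> (forall y, nondecreasing_seq (g ^~ y)) ->
  E (fun y => ereal_sup (range (g ^~ y))) <= ereal_sup (range (fun n => E (g n))).
Proof.
move=> Bg gnd; set h := fun y => _; set alpha := ereal_sup _.
have gh n y : g n y <= h y by apply: ereal_sup_ubound; exists n.
have Bh y : B%:E <= h y by exact: le_trans (Bg 0%N y) (gh _ _).
have Ealpha n : E (g n) <= alpha by apply: ereal_sup_ubound; exists n.
have bg n : bounded_below (g n) by exists B.
case: (eqVneq alpha +oo) => [->|alphay]; first exact: leey.
have Balpha : B%:E <= alpha := le_trans (upper_ge (Bg 0%N)) (Ealpha 0%N).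
have [al alE] : exists al, alpha = al%:E.
  by move: alphay Balpha; case: (alpha) => // r _ _; exists r.
pose ind y : \bar R := if h y == +oo then 1 else 0.
have ind0 y : 0 <= ind y by rewrite /ind; case: ifP.
have bind : bounded_below ind by exists 0%R.
have big (K : R) : exists n, forall y, h y = +oo -> (K + `|B|)%:E <= g n y.
  have [|N HN] := @finite_threshold (fun y n => h y = +oo -> (K + `|B|)%:E <= g n y).
    move=> y; have [hy|hy] := eqVneq (h y) +oo; last first.
      by exists 0%N => n _ hy'; rewrite hy' eqxx in hy.
    have : (K + `|B|)%:E < h y by rewrite hy ltry.
    move=> /ereal_sup_gt [_ [N _ <-] KN]; exists N => n Nn _.
    exact: le_trans (ltW KN) (gnd y _ _ Nn).
  by exists N => y hy; exact: HN.
have Eind0 : E ind = 0.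
  have E0 : 0 <= E ind by exact: (@upper_ge 0%R).
  apply/eqP; rewrite eq_le E0 andbT leNgt; apply/negP => Epos.
  (* Adding [|B|] makes every [g n] non-negative, so for a suitable [n] it dominates [K * ind]
     everywhere. *)
  have bound (K : R) : (0 < K)%R -> K%:E * E ind <= (al + `|B|)%:E.
    move=> K0; have [n Hn] := big K.
    rewrite -(upper_homogeneous HE)//.
    apply: (@le_trans _ _ (E (fun y => g n y + `|B|%:E))).
      apply: (upper_monotone HE).
      - by exists 0%R => y; rewrite mule_ge0// lee_fin ltW.
      - by apply: bounded_belowD => //; exists `|B|%R.
      - move=> y; rewrite /ind; case: eqP => hy.
          rewrite mule1; apply: (@le_trans _ _ (K + `|B|)%:E).
            by rewrite lee_fin lerDl.
          by rewrite (le_trans (Hn y hy))// leeDl// lee_fin.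
        rewrite mule0; apply: (@le_trans _ _ (B%:E + `|B|%:E)); last exact: leeD.
        by rewrite -EFinD lee_fin; have := ler_norm (- B); rewrite normrN; lra.
    apply: (le_trans (upperD _ _)) => //; first by exists `|B|%R.
    by rewrite (upper_cst HE) EFinD leeD// -alE.
  have pos : (0 < al + `|B| + 1)%R.
    have := Balpha; rewrite alE lee_fin; have := ler_norm (- B).
    by rewrite normrN; lra.
  (* If [E ind] is a positive real [e], the chosen [K] makes [K * e] exceed the bound; if it is
     [+oo], already [K = 1] does. *)
  case: (E ind) Epos bound => [e| |] //.
    rewrite lte_fin => e0 /(_ ((al + `|B| + 1) / e)%R).
    rewrite divr_gt0// => /(_ erefl).
    by rewrite -EFinM lee_fin divfK ?gt_eqF//; lra.
  by move=> _ /(_ 1%R ltr01); rewrite mul1e leNgt ltry.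
apply/lee_addgt0Pr => d d0.
(* Where [h] is finite the slack [d] absorbs the error; where it is infinite the last term is [+oo],
   and it costs nothing because [E ind = 0]. *)
have [|N HN] := @finite_threshold (fun y n => h y <= g n y + d%:E + +oo * ind y).
  move=> y; have [hy|hy] := eqVneq (h y) +oo.
    exists 0%N => n _; rewrite /ind hy eqxx mule1 addey ?leey//.
    by have := Bg n y; case: (g n y).
  have hfin : h y \is a fin_num.
    by move: hy (Bh y); case: (h y).
  have : h y - d%:E < h y by rewrite lteBlDr// lteDl// lte_fin.
  move=> /ereal_sup_gt [_ [N _ <-] KN]; exists N => n Nn.
  rewrite /ind (negbTE hy) mule0 adde0 -leeBlDr//.
  exact: le_trans (ltW KN) (gnd y _ _ Nn).
have bi : bounded_below (fun y => +oo * ind y).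
  by exists 0%R => y; rewrite mule_ge0.
have bgd : bounded_below (fun y => g N y + d%:E).
  by apply: bounded_belowD => //; exists d.
apply: (@le_trans _ _ (E (fun y => g N y + d%:E + +oo * ind y))).
  apply: (upper_monotone HE); [by exists B|exact: bounded_belowD|].
  by move=> y; exact: HN.
apply: (le_trans (upperD bgd bi)).
rewrite (upper_homogeneous HE)// Eind0 mule0 adde0.
apply: (le_trans (upperD _ _)) => //; first by exists d.
by rewrite (upper_cst HE) leeD.
Qed.

End LocalModel.

(** * Paths, cylinders and compactness of the path space *)

Section Paths.
Variable X : finType.
Implicit Types (w : sample_path X) (s t : situation X).

Lemma size_initial w n : size (initial w n) = n.
Proof. exact: size_mkseq. Qed.

Lemma initialS w n : initial w n.+1 = rcons (initial w n) (w n).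
Proof. exact: mkseqS. Qed.

Lemma take_initial w i n : (i <= n)%N -> take i (initial w n) = initial w i.
Proof. by move=> ile; rewrite /initial /mkseq -map_take take_iota (minn_idPl ile). Qed.

Lemma cylinder_initialP w w' n :
  cylinder (initial w n) w' <-> initial w' n = initial w n.
Proof. by rewrite /cylinder /= size_initial. Qed.

Lemma prefix_initialP s w n : (size s <= n)%N ->
  prefix s (initial w n) <-> cylinder s w.
Proof.
by move=> sn; rewrite prefixE take_initial//; split=> [/eqP|/= ->].
Qed.

Lemma initial_le w w' m n : (m <= n)%N -> initial w n = initial w' n ->
  initial w m = initial w' m.
Proof. by move=> mn E; rewrite -(take_initial w mn) E take_initial. Qed.

Lemma exists_path_along (next : situation X -> X) s :
  exists2 w, cylinder s w & forall n, (size s <= n)%N -> w n = next (initial w n).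
Proof.
(* The first [size s] states copy [s]; later ones follow [next]. *)
pose e n t := if (n < size s)%N then nth (next [::]) s n else next t.
pose fix pre n := if n is k.+1 then rcons (pre k) (e k (pre k)) else [::].
pose w n := e n (pre n).
have ipre n : initial w n = pre n by elim: n => [//|n IH]; rewrite initialS IH.
exists w.
  rewrite /cylinder /= -[RHS](mkseq_nth (next [::])).
  apply/eq_in_map => i; rewrite mem_iota add0n /= => si.
  by rewrite /w /e si.
by move=> n sn; rewrite ipre /w /e ltnNge sn.
Qed.

(** Koenig's lemma. A bad situation has a bad child, since otherwise the maximum of the children's
    finitely many bounds would serve the parent. Without a uniform bound the root is bad, and bad
    children form a path all of whose prefixes are bad, although one of them lies in [D]. *)
Lemma konig (D : situation X -> Prop) :
  (forall w, exists n, D (initial w n)) ->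
  exists N, forall w, exists2 n, (n <= N)%N & D (initial w n).
Proof.
move=> HD; apply: contrapT => noN.
pose bad t := forall N, exists2 w, cylinder t w &
  forall n, (n <= N)%N -> ~ D (initial w n).
have bad0 : bad [::].
  move=> N; apply: contrapT => H; apply: noN; exists N => w.
  apply: contrapT => H'; apply: H; exists w => // n nN Dn.
  by apply: H'; exists n.
have [w0 _ _] := bad0 0%N.
have badS t : exists x, bad t -> bad (rcons t x).
  apply: contrapT => H.
  have {}H x : bad t /\ ~ bad (rcons t x).
    split; apply: contrapT => b; apply: H; exists x => // bt.
    by apply: contrapT.
  have bt : bad t := (H (w0 0%N)).1.
  have /choice [N HN] : forall x, exists N, ~ (exists2 w, cylinder (rcons t x) w &
      forall n, (n <= N)%N -> ~ D (initial w n)).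
    by move=> x; apply/existsNP => b; case: (H x).
  have [w tw wN] := bt (\max_x N x).
  apply: (HN (w (size t))); exists w => [|n nN].
    by rewrite /cylinder /= size_rcons initialS tw.
  by apply: wN; apply: leq_trans nN _; exact: leq_bigmax.
have [next Hnext] := choice badS.
have [w _ Hw] := exists_path_along next [::].
have badw n : bad (initial w n).
  by elim: n => [//|n IH]; rewrite initialS Hw//; exact: Hnext.
have [n Dn] := HD w.
have [w' ww' /(_ n (leqnn n))] := badw n n.
by move/cylinder_initialP : ww' => ->.
Qed.

End Paths.

(** * Supermartingales and basic properties of the global upper expectation *)

Section Supermartingales.
Variables (R : realType) (X : finType) (Q : situation X -> (X -> \bar R) -> \bar R).
Hypothesis HQ : probability_tree Q.
Implicit Types (w : sample_path X) (s t : situation X).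
Implicit Types (f g : sample_path X -> \bar R) (M S : situation X -> \bar R).
Implicit Types (D : pred (situation X)) (F : situation X -> situation X -> \bar R).

Lemma bounded_below_children M t :
  bounded_below M -> bounded_below (fun x => M (rcons t x)).
Proof. by case=> B HB; exists B. Qed.

Lemma supermartingale_cst (c : \bar R) : -oo < c -> supermartingale Q (fun=> c).
Proof.
move=> c0; split=> [|s].
  by case: c c0 => [c| |] // _; [exists c|exists 0%R => ?; exact: leey].
apply: (upper_le_cst (HQ s)) => //.
by case: c c0 => [c| |] // _; [exists c|exists 0%R => ?; exact: leey].
Qed.

Lemma supermartingaleD M M' : supermartingale Q M -> supermartingale Q M' ->
  supermartingale Q (fun t => M t + M' t).
Proof.
move=> [bM HM] [bM' HM']; split; first exact: bounded_belowD.
move=> s; apply: (le_trans (upperD (HQ s) _ _)).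
- exact: bounded_below_children.
- exact: bounded_below_children.
- exact: leeD.
Qed.

Lemma supermartingaleZ M (c : R) : (0 < c)%R -> (forall t, 0 <= M t) ->
  supermartingale Q M -> supermartingale Q (fun t => c%:E * M t).
Proof.
move=> c0 M0 [bM HM]; split.
  by exists 0%R => t; rewrite mule_ge0// lee_fin ltW.
move=> s; rewrite (upper_homogeneous (HQ s))//; last exact: bounded_below_children.
by rewrite lee_pmul2l.
Qed.

Lemma supermartingale_sup (B : R) (M : nat -> situation X -> \bar R) :
  (forall n t, B%:E <= M n t) -> (forall t, nondecreasing_seq (M ^~ t)) ->
  (forall n, supermartingale Q (M n)) ->
  supermartingale Q (fun t => ereal_sup (range (M ^~ t))).
Proof.
move=> BM Mnd HM; split.
  exists B => t; apply: (le_trans (BM 0%N t)).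
  by apply: ereal_sup_ubound; exists 0%N.
move=> s; have := @upper_sup_nondecreasing _ _ _ (HQ s) B
  (fun n x => M n (rcons s x)) (fun n x => BM _ _) (fun x => Mnd _).
move=> /le_trans; apply; apply: ge_ereal_sup => _ [n _ <-].
apply: (le_trans ((HM n).2 s)).
by apply: ereal_sup_ubound; exists n.
Qed.

(** If all children exceeded [M t], so would their minimum, as there are finitely many, and hence
    the local upper expectation, against the supermartingale inequality. *)
Lemma supermartingale_child_le M t : supermartingale Q M ->
  exists x, M (rcons t x) <= M t.
Proof.
move=> [bM HM]; apply: contrapT => H.
have {}H x : M t < M (rcons t x).
  by rewrite ltNge; apply/negP => le; apply: H; exists x.
(* Nothing exceeds [+oo], so [X] would be empty here; then the constants 0 and 1 would be one map
   with two upper expectations. *)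
case: (eqVneq (M t) +oo) => [Mty|Mty].
  have [B HB] := bM.
  have : (1 + 1)%:E <= Q t (fun x => M (rcons t x)).
    by apply: (upper_ge (HQ t)) => x; have := H x; rewrite Mty ltNge leey.
  have noX (x : X) : False by have := H x; rewrite Mty ltNge leey.
  have E01 : (fun=> 0%:E) = (fun=> 1%:E) :> (X -> \bar R).
    by apply/funext => x; case: (noX x).
  have := upper_cst (HQ t) 0%R; rewrite E01 (upper_cst (HQ t)) => -[/eqP].
  by rewrite oner_eq0.
have [m Mm] : exists m, M t = m%:E.
  have [B /(_ t)] := bM.
  by move: Mty; case: (M t) => // m _ _; exists m.
(* The cap [m + 1] keeps the minimum real when every child has value [+oo]. *)
pose c := \big[mine/(m + 1)%:E]_x M (rcons t x).
have mc : M t < c.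
  by apply: lt_bigmin => [|x _]; [rewrite Mm lte_fin ltrDl|exact: H].
have [c' cc'] : exists c', c = c'%:E.
  have : c <= (m + 1)%:E by exact: bigmin_le_id.
  by move: mc; rewrite Mm; case: (c) => // c' _ _; exists c'.
have : c <= Q t (fun x => M (rcons t x)).
  by rewrite cc'; apply: (upper_ge (HQ t)) => x; rewrite -cc'; exact: bigmin_le_cond.
by move=> /le_trans/(_ (HM t)); rewrite leNgt mc.
Qed.

(** Moving from [s] always to a child with no larger value gives a path along which [M] stays below
    [M s]. *)
Lemma supermartingale_ge_liminf M s (c : \bar R) : supermartingale Q M ->
  (forall w, cylinder s w -> c <= liminf_along M w) -> c <= M s.
Proof.
move=> HM cM.
have /choice [next Hnext] := fun t => supermartingale_child_le t HM.
have [w sw Hw] := exists_path_along next s.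
have dec k : M (initial w (size s + k)) <= M s.
  elim: k => [|k IH]; first by rewrite addn0 sw.
  by rewrite addnS initialS Hw ?leq_addr//; exact: le_trans (Hnext _) IH.
apply: (le_trans (cM w sw)); rewrite -(limn_einf_cst (M s)).
apply: (@le_limn_einf _ _ _ (size s)) => n sn.
by rewrite -(subnKC sn); exact: dec.
Qed.

Lemma global_upper_le M f s : supermartingale Q M ->
  (forall w, cylinder s w -> f w <= liminf_along M w) -> global_upper Q f s <= M s.
Proof. by move=> HM fM; apply: ereal_inf_lbound; exists M. Qed.

Lemma le_global_upper f g s : (forall w, cylinder s w -> f w <= g w) ->
  global_upper Q f s <= global_upper Q g s.
Proof.
move=> fg; apply: le_ereal_inf_tmp => _ [M [HM gM] <-].
by apply: global_upper_le => // w sw; exact: le_trans (fg w sw) (gM w sw).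
Qed.

Lemma global_upper_ge (c : \bar R) f s : (forall w, cylinder s w -> c <= f w) ->
  c <= global_upper Q f s.
Proof.
move=> cf; apply: le_ereal_inf_tmp => _ [M [HM gM] <-].
by apply: supermartingale_ge_liminf => // w sw; exact: le_trans (cf w sw) (gM w sw).
Qed.

(** A supermartingale competing in the infimum at [s] also competes at every child of [s], so
    monotonicity of [Q s] compares the two infima. *)
Lemma supermartingale_global_upper (B : R) f : (forall w, B%:E <= f w) ->
  supermartingale Q (global_upper Q f).
Proof.
move=> Bf; split; first by exists B => t; exact: global_upper_ge.
move=> s; apply: le_ereal_inf_tmp => _ [M [HM gM] <-].
apply: le_trans (HM.2 s); apply: (upper_monotone (HQ s)).
- by exists B => x; exact: global_upper_ge.
- exact: bounded_below_children HM.1.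
- move=> x; apply: global_upper_le => // w; rewrite /cylinder /= size_rcons initialS.
  by move=> /eqP; rewrite eqseq_rcons => /andP[/eqP sw _]; exact: gM.
Qed.

(* Off the subtree at [s] a supermartingale may be replaced by +oo. *)
Lemma global_upper_lt (B : R) f s (a : \bar R) : (forall w, B%:E <= f w) ->
  global_upper Q f s < a ->
  exists M, [/\ supermartingale Q M, forall t, B%:E <= M t, M s < a &
    forall w, f w <= liminf_along M w].
Proof.
move=> Bf /ereal_inf_lt [_ [M [HM fM] <-] Ma].
pose M' t := if prefix s t then M t else +oo.
have BM' t : B%:E <= M' t.
  rewrite /M'; case: ifP => [st|_]; last exact: leey.
  apply: supermartingale_ge_liminf => // w tw.
  apply: le_trans (Bf w) (fM w _).
  move: st => /prefixP[u tE]; rewrite /cylinder /= in tw *.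
  rewrite -(take_initial w (_ : (size s <= size t)%N)); last by rewrite tE size_cat leq_addr.
  by rewrite tw tE take_size_cat.
exists M'; split => //.
- split; first by exists B.
  move=> t; rewrite {2}/M'; case: ifP => [st|_]; last exact: leey.
  have -> : (fun x => M' (rcons t x)) = (fun x => M (rcons t x)).
    apply/funext => x; rewrite /M' -cats1.
    by rewrite (prefix_trans st (prefix_prefix _ _)).
  exact: HM.2.
- by rewrite /M' prefix_refl.
- move=> w; have [sw|sw] := pselect (cylinder s w).
    apply: (le_trans (fM w sw)); apply: (@le_limn_einf _ _ _ (size s)) => n sn.
    by rewrite /M' (prefix_initialP _ sn).2.
  apply: (@le_trans _ _ +oo); first exact: leey.
  apply: (@limn_einf_ge _ _ _ (size s)) => n sn; rewrite /M'.
  by case: ifP => // /(prefix_initialP _ sn).1.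
Qed.

(** * Stopping and switching at a first hitting time *)

Definition hits D t :=
  has (fun i => D (take i t)) (iota 0 (size t).+1).
(** The length of the shortest prefix of [t] in [D], and [size t + 1] if there is none. *)
Definition first_hit D t :=
  find (fun i => D (take i t)) (iota 0 (size t).+1).
(** A stopped process with continuation: [F] receives the hitting situation as well as the current
    one, so what follows may depend on where the switch occurred. *)
Definition switch D S F t :=
  if hits D t then F (take (first_hit D t) t) t else S t.

Lemma hits_first_hit D t : hits D t -> D (take (first_hit D t) t).
Proof.
move=> h; have := nth_find 0%N h; rewrite nth_iota//.
by move: h; rewrite /hits has_find size_iota.
Qed.

Lemma first_hitE D t n : (n <= size t)%N -> D (take n t) ->
  (forall i, (i < n)%N -> ~~ D (take i t)) -> hits D t /\ first_hit D t = n.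
Proof.
move=> nt Dn Di.
have h : hits D t by apply/hasP; exists n => //; rewrite mem_iota ltnS.
split=> //; apply/eqP; rewrite eqn_leq; apply/andP; split; rewrite leqNgt; apply/negP.
  move=> /(before_find 0%N); rewrite nth_iota; last by rewrite ltnS.
  by rewrite add0n Dn.
by move=> /Di; rewrite hits_first_hit.
Qed.

Lemma switch_hit D S F w m n : (n <= m)%N -> D (initial w n) ->
  (forall i, (i < n)%N -> ~~ D (initial w i)) ->
  switch D S F (initial w m) = F (initial w n) (initial w m).
Proof.
move=> nm Dn Di; rewrite /switch.
have [|||-> ->] := @first_hitE D (initial w m) n.
- by rewrite size_initial.
- by rewrite take_initial.
- by move=> i ilt; rewrite take_initial ?Di// ltnW// (leq_trans ilt).
- by rewrite take_initial.
Qed.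

Lemma switch_le D S F t :
  (forall v, D v -> F v v <= S v) ->
  (forall i, (i < size t)%N -> ~~ D (take i t)) -> switch D S F t <= S t.
Proof.
move=> FS Di; rewrite /switch; case: ifP => // h.
have Dt := hits_first_hit h.
have : (size t <= first_hit D t)%N.
  by rewrite leqNgt; apply/negP => /Di; rewrite Dt.
by move=> /take_oversize tE; move: Dt; rewrite tE => /FS.
Qed.

Lemma switch_ge (c : \bar R) D S F :
  (forall t, c <= S t) -> (forall v t, D v -> c <= F v t) ->
  forall t, c <= switch D S F t.
Proof.
move=> cS cF t; rewrite /switch; case: ifP => // h.
by apply: cF; exact: hits_first_hit.
Qed.

(** After the hit, a situation and its children use the same [F v]. Before it, the value is that of
    [S], and switching at a child can only lower the value there. *)
Lemma supermartingale_switch (B : R) D S F :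
  (forall t, B%:E <= S t) -> (forall v t, D v -> B%:E <= F v t) ->
  supermartingale Q S -> (forall v, D v -> supermartingale Q (F v)) ->
  (forall v, D v -> F v v <= S v) -> supermartingale Q (switch D S F).
Proof.
move=> BS BF HS HF FS; have Bsw := switch_ge BS BF.
split; first by exists B.
move=> t.
have hitsS x : hits D (rcons t x) = hits D t || D (rcons t x).
  rewrite /hits size_rcons -addn1 iotaD has_cat has_seq1 add0n; congr (_ || _).
    apply: eq_in_has => i; rewrite mem_iota ltnS /= => it.
    by rewrite -cats1 takel_cat.
  by rewrite take_oversize// size_rcons.
have [h|h] := boolP (hits D t).
  have fh x : first_hit D (rcons t x) = first_hit D t.
    have ft : (first_hit D t <= size t)%N.
      by have := h; rewrite /hits has_find size_iota ltnS.
    have /first_hitE[] // : forall i, (i < first_hit D t)%N -> ~~ D (take i (rcons t x)).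
      move=> i ilt; rewrite -cats1 takel_cat; last by rewrite ltnW// (leq_trans ilt).
      have := before_find 0%N ilt; rewrite nth_iota ?add0n; last first.
        by rewrite ltnS ltnW// (leq_trans ilt).
      by move=> ->.
    - by rewrite size_rcons (leq_trans ft).
    - by rewrite -cats1 takel_cat// hits_first_hit.
  set v := take (first_hit D t) t.
  have Dv : D v by exact: hits_first_hit.
  have -> : (fun x => switch D S F (rcons t x)) = (fun x => F v (rcons t x)).
    apply/funext => x; rewrite /switch hitsS h /= fh; congr (F _ _).
    rewrite -cats1 takel_cat//.
    by have := h; rewrite /hits has_find size_iota ltnS.
  by rewrite /switch h; exact: (HF v Dv).2.
rewrite {2}/switch (negbTE h); apply: le_trans (HS.2 t).
apply: (upper_monotone (HQ t)).
- by exists B.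
- exact: bounded_below_children HS.1.
- move=> x; apply: switch_le => // i; rewrite size_rcons ltnS => it.
  rewrite -cats1 takel_cat//; apply/negP => Di; move/hasP : h; apply.
  by exists i => //; rewrite mem_iota ltnS.
Qed.

End Supermartingales.

(** * Null sets, Levy's zero-one law and Fatou's lemma *)

Lemma rat_between (R : realType) (x y : \bar R) : x < y ->
  exists r : rat, x < (ratr r)%:E < y.
Proof.
have real_between (a b : R) : (a < b)%R -> exists r : rat, a%:E < (ratr r)%:E < b%:E.
  by move=> ab; have [r] := rat_in_itvoo ab; rewrite in_itv /= => rab; exists r; rewrite !lte_fin.
case: x y => [a| |] [b| |] //=.
- by rewrite lte_fin; exact: real_between.
- move=> _; have [|r /andP[ar _]] := @real_between a (a + 1)%R; first by rewrite ltrDl.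
  by exists r; rewrite ar ltry.
- move=> _; have [|r /andP[_ rb]] := @real_between (b - 1)%R b; first by rewrite ltrBlDr ltrDl.
  by exists r; rewrite rb ltNyr.
- by move=> _; exists (0%R : rat); rewrite ltNyr ltry.
Qed.

Section NullSets.
Variables (R : realType) (X : finType) (Q : situation X -> (X -> \bar R) -> \bar R).
Hypothesis HQ : probability_tree Q.
Implicit Types (w : sample_path X) (s t : situation X) (N : set (sample_path X)).
Implicit Types (f g : sample_path X -> \bar R) (M S : situation X -> \bar R).

(** Nullity in the betting sense: [M] is a capital process that reaches level 1 on [N] from
    arbitrarily little capital. The level is a normalization, as scaling shows. *)
Definition null_set N := forall s (e : R), (0 < e)%R ->
  exists M, [/\ supermartingale Q M, forall t, 0 <= M t, M s <= e%:E &
    forall w, N w -> 1 <= liminf_along M w].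

Lemma liminf_switch (D : pred (situation X)) S F w : (exists n, D (initial w n)) ->
  exists2 n, D (initial w n) &
    liminf_along (switch D S F) w = liminf_along (F (initial w n)) w.
Proof.
move=> /ex_minnP [n Dn minn]; exists n => //.
apply: (@limn_einf_eq _ _ _ n) => m nm; apply: switch_hit => // i iltn.
by apply/negP => /minn; rewrite leqNgt iltn.
Qed.

Lemma exists_expr_lt (r e : R) : (0 <= r < 1)%R -> (0 < e)%R -> exists n, (r ^+ n < e)%R.
Proof.
move=> /andP[r0 r1] e0.
have /cvgrPdist_lt /(_ e e0) [n _ /(_ n (leqnn n))] : GRing.exp r @ \oo --> (0%R : R).
  by apply: cvg_expr; rewrite ger0_norm.
by rewrite /= sub0r normrN ger0_norm ?exprn_ge0// => H; exists n.
Qed.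

(* Levy's zero-one law, one crossing at a time.  Wait until the conditional
   upper expectation is below [a], then follow a supermartingale that starts
   below [a] and dominates [f] until it exceeds [b], and start afresh.  One such
   round multiplies a bound on the price of the event by (a - B) / (b - B). *)
Lemma null_set_downcrossing (B : R) f (a b : R) : (forall w, B%:E <= f w) -> (a < b)%R ->
  null_set [set w | liminf_along (global_upper Q f) w < a%:E /\ b%:E < f w].
Proof.
move=> Bf0 ab; set N := [set w | _].
(* Lowering [B] is harmless and places the ratio [r] strictly between 0 and 1. *)
wlog Ba : B Bf0 / (B < a)%R.
  move=> /(_ (Num.min B (a - 1))%R); apply.
    by move=> w; apply: le_trans (Bf0 w); rewrite lee_fin ge_min lexx.
  by rewrite gt_min; apply/orP; right; lra.
set V := global_upper Q f.
(* The price bound [q] is uniform over situations, so that a new round can start anywhere. *)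
pose good (q : R) := forall s, exists M, [/\ supermartingale Q M, forall t, 0 <= M t,
  M s <= q%:E & forall w, N w -> 1 <= liminf_along M w].
pose r := ((a - B) / (b - B))%R.
have bB0 : (0 < b - B)%R by lra.
have step q : (0 < q)%R -> good q -> good (r * q)%R.
  move=> q0 /choice [G HG] s.
  (* The length condition excludes a switch before [s], so the value at [s] is at most the initial
     constant [r * q]. *)
  pose D0 u := (size s <= size u)%N && (V u < a%:E).
  have /choice [Mu HMu] : forall u, exists M, D0 u -> [/\ supermartingale Q M,
      forall t, B%:E <= M t, M u < a%:E & forall w, f w <= liminf_along M w].
    move=> u; have [|D0u] := boolP (D0 u).
      by move=> /andP[_ /(global_upper_lt HQ Bf0) [M HM]]; exists M.
    by exists (fun=> 0).
  pose D1 u v := (size u <= size v)%N && (b%:E < Mu u v).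
  (* Scaling by [c] turns the level [b - B] into [q], the price of restarting with [G], and [a - B]
     into [r * q]. *)
  pose c := (q / (b - B))%R.
  have c0 : (0 < c)%R by rewrite divr_gt0.
  pose S1 u v := c%:E * (Mu u v + (- B)%:E).
  pose F u := switch (D1 u) (S1 u) G.
  have sh0 u v : D0 u -> 0 <= Mu u v + (- B)%:E.
    by move=> /HMu[_ /(_ v) BM _ _]; rewrite -(subee (_ : B%:E \is a fin_num))// leeD.
  have S10 u v : D0 u -> 0 <= S1 u v.
    by move=> D0u; rewrite /S1 mule_ge0 ?sh0// lee_fin ltW.
  have rqE : (r * q = c * (a - B))%R by rewrite /r /c mulrAC [RHS]mulrAC [(q * _)%R]mulrC.
  have rq0 : (0 <= r * q)%R by rewrite rqE mulr_ge0; lra.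
  have GS1 u v : D1 u v -> G v v <= S1 u v.
    move=> /andP[_ bM]; have [_ _ Gq _] := HG v; apply: (le_trans Gq).
    have -> : q = (c * (b - B))%R by rewrite /c divfK// gt_eqF.
    rewrite EFinM /S1; apply: lee_wpmul2l; first by rewrite lee_fin ltW.
    by rewrite EFinB leeD// ltW.
  have Frq u : D0 u -> F u u <= (r * q)%:E.
    move=> D0u; apply: (@le_trans _ _ (S1 u u)).
      apply: switch_le; first exact: GS1.
      move=> i iu; rewrite /D1 size_take iu; apply/negP => /andP[].
      by rewrite leqNgt iu.
    rewrite rqE EFinM /S1; apply: lee_wpmul2l; first by rewrite lee_fin ltW.
    by have [_ _ /ltW Ma _] := HMu u D0u; rewrite EFinB leeD.
  have F0 u t : D0 u -> 0 <= F u t.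
    by move=> D0u; apply: switch_ge => [v|v v' _]; [exact: S10|have [] := HG v].
  have HF u : D0 u -> supermartingale Q (F u).
    move=> D0u; apply: (@supermartingale_switch _ _ _ HQ 0%R).
    - by move=> v; exact: S10.
    - by move=> v t _; have [] := HG v.
    - apply: supermartingaleZ => //; first by move=> v; exact: sh0.
      apply: supermartingaleD => //; first by have [] := HMu u D0u.
      by apply: supermartingale_cst => //; exact: ltNyr.
    - by move=> v _; have [] := HG v.
    - exact: GS1.
  exists (switch D0 (fun=> (r * q)%:E) F); split.
  - apply: (@supermartingale_switch _ _ _ HQ 0%R) => //.
    by apply: supermartingale_cst => //; exact: ltNyr.
  - by apply: switch_ge => // v t; exact: F0.
  - apply: (@switch_le _ _ D0 (fun=> (r * q)%:E)) => // i is_.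
    by rewrite /D0 size_take is_; apply/negP => /andP[]; rewrite leqNgt is_.
  (* On [N] both switches occur: [V] drops below [a] at arbitrarily late times, and then [Mu]
     exceeds [b] because its limit inferior dominates [f]. *)
  - move=> w Nw; have [Va bf] := Nw.
    have [|n D0n ->] := @liminf_switch D0 (fun=> (r * q)%:E) F w.
      have [n sn Vn] := limn_einf_lt (size s) Va.
      by exists n; rewrite /D0 size_initial sn.
    have [_ _ _ fM] := HMu _ D0n.
    have [|m D1m ->] := @liminf_switch (D1 (initial w n)) (S1 (initial w n)) G w.
      have [m Hm] := limn_einf_gt (lt_le_trans bf (fM w)).
      exists (maxn n m); rewrite /D1 !size_initial leq_maxl /=.
      by apply: Hm; exact: leq_maxr.
    by have [_ _ _ HGv] := HG (initial w m); exact: HGv.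
have r01 : (0 < r < 1)%R.
  by rewrite /r divr_gt0 ?ltr_pdivrMr ?mul1r//; lra.
have goodn n : good (r ^+ n)%R.
  elim: n => [|n IH].
    move=> s; exists (fun=> 1); split=> //.
      by apply: supermartingale_cst => //; exact: ltNyr.
    by move=> w _; rewrite /liminf_along limn_einf_cst.
  by rewrite exprS; apply: step => //; rewrite exprn_gt0//; case/andP: r01.
move=> s e e0; have [|n rne] := @exists_expr_lt r e _ e0.
  by case/andP: r01 => r0 ->; rewrite ltW.
have [M [HM M0 Me NM]] := goodn n s.
by exists M; split=> //; apply: (le_trans Me); rewrite lee_fin ltW.
Qed.

(** The pairs [(i, K)] are enumerated; the process for the pair coded by [j] costs at most
    [e / 2 ^ (j + 1)] and has limit inferior at least [K] on [N i]. The sum of all of them is a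
    supermartingale by continuity from below. *)
Lemma null_set_countable (I : countType) (N : I -> set (sample_path X)) s (e : R) :
  (forall i, null_set (N i)) -> (0 < e)%R ->
  exists T, [/\ supermartingale Q T, forall t, 0 <= T t, T s <= e%:E &
    forall i w, N i w -> liminf_along T w = +oo].
Proof.
move=> Nnull e0.
pose ej j : R := (e / 2 ^+ j.+1)%R.
have ej0 j : (0 < ej j)%R by rewrite divr_gt0// exprn_gt0.
have /choice [T HT] : forall j, exists M, [/\ supermartingale Q M, forall t, 0 <= M t,
    M s <= (ej j)%:E & forall i K, unpickle j = Some (i, K) ->
      forall w, N i w -> (K : nat)%:R%:E <= liminf_along M w].
  move=> j; case uj : (@unpickle (I * nat)%type j) => [[i K]|]; last first.
    exists (fun=> 0); split=> //.
      by apply: supermartingale_cst => //; exact: ltNyr.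
    by rewrite lee_fin ltW.
  (* A limit inferior of at least 1 only gives values eventually above 1/2, hence the factor 2; the
     added 1 keeps [k] positive when [K = 0]. *)
  pose k : R := (K%:R * 2 + 1)%R.
  have k0 : (0 < k)%R by rewrite /k; have : (0 <= K%:R :> R)%R by []; lra.
  have [|M [HM M0 Me NM]] := Nnull i s (ej j / k)%R; first by rewrite divr_gt0.
  exists (fun t => k%:E * M t); split.
  - exact: supermartingaleZ.
  - by move=> t; rewrite mule_ge0// lee_fin ltW.
  - apply: (@le_trans _ _ (k%:E * (ej j / k)%:E)); last first.
      by rewrite -EFinM mulrC divfK// gt_eqF.
    by apply: lee_wpmul2l => //; rewrite lee_fin ltW.
  - move=> _ _ [<- <-] w Nw.
    have h1 : (1 / 2)%:E < liminf_along M w.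
      by apply: lt_le_trans (NM w Nw); rewrite lte_fin; lra.
    have [n Hn] := limn_einf_gt h1; apply: (@limn_einf_ge _ _ _ n) => m nm.
    apply: (@le_trans _ _ (k%:E * (1 / 2)%:E)).
      by rewrite -EFinM lee_fin /k; lra.
    by apply: lee_wpmul2l; [rewrite lee_fin ltW|exact: ltW (Hn m nm)].
pose P n t := \sum_(j < n) T j t.
have T0 j t : 0 <= T j t by have [] := HT j.
have P0 n t : 0 <= P n t by apply: sume_ge0.
have PS n : P n.+1 = (fun t => P n t + T n t).
  by apply/funext => t; rewrite /P big_ord_recr.
have HP n : supermartingale Q (P n).
  elim: n => [|n IH].
    have -> : P 0%N = fun=> 0 by apply/funext => t; rewrite /P big_ord0.
    by apply: supermartingale_cst => //; exact: ltNyr.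
  by rewrite PS; apply: supermartingaleD => //; have [] := HT n.
have Pe n : P n s <= (e - e / 2 ^+ n)%:E.
  elim: n => [|n IH]; first by rewrite /P big_ord0 expr0 divr1 subrr.
  have [_ _ Tn _] := HT n.
  rewrite PS; apply: (le_trans (leeD IH Tn)).
  rewrite -EFinD lee_fin /ej exprS invfM.
  by set x := (2 ^+ n)^-1%R; lra.
exists (fun t => ereal_sup (range (P ^~ t))); split.
- apply: (@supermartingale_sup _ _ _ HQ 0%R) => // t.
  by apply/nondecreasing_seqP => n; rewrite PS leeDl.
- by move=> t; apply: (le_trans (P0 0%N t)); apply: ereal_sup_ubound; exists 0%N.
- apply: ge_ereal_sup => _ [n _ <-]; apply: (le_trans (Pe n)).
  by rewrite lee_fin lerBlDr lerDl divr_ge0// ?exprn_ge0// ltW.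
- move=> i w Nw; apply/eqyP => A A0.
  pose K := (Num.trunc A).+1.
  have AK : (A <= K%:R)%R by rewrite ltW// /K truncnS_gt.
  apply: (@le_trans _ _ K%:R%:E) => //.
  pose j := pickle (i, K).
  have [_ _ _ /(_ i K (pickleK _) w Nw)] := HT j.
  move=> /le_trans; apply; apply: (@le_limn_einf _ _ _ 0%N) => n _.
  apply: (@le_trans _ _ (P j.+1 (initial w n))); first by rewrite PS leeDr.
  by apply: ereal_sup_ubound; exists j.+1.
Qed.

(** The tail infima [h n] increase, so their upper expectations [V n] increase to a supermartingale
    [V']. By Levy's law [V'] has limit inferior at least that of the [fn] off countably many null
    sets, which [T] repairs at cost [e]. *)
Lemma global_upper_fatou (B : R) (fn : nat -> sample_path X -> \bar R) f s :
  (forall n w, B%:E <= fn n w) -> (forall w, f w <= limn_einf (fn ^~ w)) ->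
  global_upper Q f s <= limn_einf (fun n => global_upper Q (fn n) s).
Proof.
move=> Bfn ffn.
pose h n w := einfs (fn ^~ w) n.
have Bh n w : B%:E <= h n w by apply: le_ereal_inf_tmp => _ [k _ <-]; exact: Bfn.
have hfn n k w : (n <= k)%N -> h n w <= fn k w.
  by move=> nk; apply: ereal_inf_lbound; exists k.
pose V n := global_upper Q (h n).
have BV n t : B%:E <= V n t by apply: global_upper_ge.
have Vnd t : nondecreasing_seq (V ^~ t).
  by move=> n m nm; apply: le_global_upper => // w _; exact: nondecreasing_einfs.
pose V' t := ereal_sup (range (V ^~ t)).
have VV' n t : V n t <= V' t by apply: ereal_sup_ubound; exists n.
have HV' : supermartingale Q V'.
  apply: (@supermartingale_sup _ _ _ HQ B) => // n.
  exact: supermartingale_global_upper.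
apply: (@le_trans _ _ (V' s)); last first.
  apply: ge_ereal_sup => _ [n _ <-]; apply: (@limn_einf_ge _ _ _ n) => k nk.
  by apply: le_global_upper => // w _; exact: hfn.
apply/lee_addgt0Pr => e e0.
(* Rational levels make the exceptional sets countable; the condition that they are ordered is part
   of the set, so that every index gives a null set. *)
pose N (i : nat * rat * rat) : set (sample_path X) := [set w | (i.1.2 < i.2)%R /\
  (liminf_along (V i.1.1) w < (ratr i.1.2)%:E /\ (ratr i.2)%:E < h i.1.1 w)].
have Nnull i : null_set (N i).
  case: i => [[n a] b]; have [ab|nab] := boolP (a < b)%R; last first.
    move=> t d d0; exists (fun=> 0); split => //.
    - by apply: supermartingale_cst => //; exact: ltNyr.
    - by rewrite lee_fin ltW.
    - by move=> w [/= ab]; rewrite ab in nab.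
  move=> t d d0; have [|M [HM M0 Md NM]] :=
    @null_set_downcrossing B (h n) (ratr a) (ratr b) (Bh n) _ t d d0.
    by rewrite ltr_rat.
  by exists M; split => // w [_]; exact: NM.
have [T [HT T0 Te NT]] := null_set_countable s Nnull e0.
apply: (@le_trans _ _ (V' s + T s)); last by rewrite leeD.
apply: (@global_upper_le _ _ _ (fun t => V' t + T t)); first exact: supermartingaleD.
move=> w _.
have [[i Nw]|noN] := pselect (exists i, N i w).
  apply: (@le_trans _ _ +oo); first exact: leey.
  have -> : +oo = B%:E + liminf_along T w by rewrite (NT i w Nw).
  rewrite /liminf_along -limn_einf_shift//.
  apply: (@le_limn_einf _ _ _ 0%N) => n _; rewrite leeD//.
  exact: le_trans (BV 0%N _) (VV' _ _).
have hV n : h n w <= liminf_along (V n) w.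
  rewrite leNgt; apply/negP => /rat_between [a /andP[Va /rat_between[b /andP[ab bh]]]].
  apply: noN; exists (n, a, b); split => //=.
  by move: ab; rewrite lte_fin ltr_rat.
apply: (le_trans (ffn w)); rewrite limn_einf_sup_einfs.
apply: ge_ereal_sup => _ [n _ <-]; apply: (le_trans (hV n)).
apply: (@le_limn_einf _ _ _ 0%N) => m _.
by apply: (le_trans (VV' n _)); rewrite leeDl.
Qed.

End NullSets.

(** Intervals with open ends form a neighbourhood base, and an infinite end imposes no condition. *)
Lemma cvg_ereal_orderP (R : realType) (u : nat -> \bar R) (l : \bar R) :
  u @ \oo --> l <->
  (forall c, c < l -> exists N, forall n, (N <= n)%N -> c < u n) /\
  (forall c, l < c -> exists N, forall n, (N <= n)%N -> u n < c).
Proof.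
split=> [ul|[lo hi]].
  have near_ex (P : set nat) : (\forall n \near \oo, P n) ->
      exists N, forall n, (N <= n)%N -> P n.
    by case=> N _ PN; exists N => n; exact: PN.
  split=> c cl; apply: near_ex.
    have : nbhs l [set x | c < x].
      apply: open_nbhs_nbhs; split => //.
      by have := @rray_open _ (\bar R) c; rewrite set_itvE.
    by move/ul.
  have : nbhs l [set x | x < c].
    apply: open_nbhs_nbhs; split => //.
    by have := @lray_open _ (\bar R) c; rewrite set_itvE.
  by move/ul.
move=> A; rewrite itv_nbhsE => -[[i j] [ij]] /= + sub.
rewrite itv_boundlr => /andP[il lj].
have [N1 H1] : exists N, forall n, (N <= n)%N -> (i <= BLeft (u n))%O.
  case: (i) il ij => [[] c|[]] // il ij.
  - move: il; rewrite bnd_simp => /lo [N HN].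
    by exists N => n /HN; rewrite bnd_simp.
  - by exists 0%N.
have [N2 H2] : exists N, forall n, (N <= n)%N -> (BRight (u n) <= j)%O.
  case: (j) lj ij => [[] c|[]] // lj ij.
  - move: lj; rewrite bnd_simp => /hi [N HN].
    by exists N => n /HN; rewrite bnd_simp.
  - by have := itv_open_ends_rside ij.
  - by exists 0%N.
exists (maxn N1 N2) => // n /=; rewrite geq_max => /andP[n1 n2].
by apply: sub => /=; rewrite itv_boundlr H1// H2.
Qed.

(** * Approximation by finitary gambles *)

Section Approximation.
Variables (R : realType) (X : finType).
Implicit Types (w : sample_path X) (s t : situation X).

Lemma nmeasurableP n (f : sample_path X -> \bar R) : nmeasurable n f <->
  forall w w', initial w n = initial w' n -> f w = f w'.
Proof.
split=> [mf w w' ww'|mf t tn w w' tw tw'].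
  by apply: (mf (initial w n)); rewrite ?size_initial//; apply/cylinder_initialP.
by apply: mf; rewrite -tn; rewrite /cylinder /= in tw tw'; rewrite tw tw'.
Qed.

Lemma nmeasurable_le m n (f : sample_path X -> \bar R) : (m <= n)%N ->
  nmeasurable m f -> nmeasurable n f.
Proof.
by move=> mn /nmeasurableP mf; apply/nmeasurableP => w w' /(initial_le mn); exact: mf.
Qed.

(** Only finitely many values occur, one for each string of length [n]; the sum of their absolute
    values is a bound. *)
Lemma bounded_nmeasurable n (f : sample_path X -> R) :
  nmeasurable n (fun w => (f w)%:E) -> bounded_fun f.
Proof.
move=> /nmeasurableP mf.
have /choice [v Hv] : forall t : n.-tuple X, exists v, forall w, initial w n = t -> f w = v.
  move=> t; have [[w wt]|now] := pselect (exists w, initial w n = t).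
    by exists (f w) => w' w't; have [] : (f w')%:E = (f w)%:E by apply: mf; rewrite wt.
  by exists 0%R => w wt; case: now; exists w.
rewrite /=; exists (\sum_(t : n.-tuple X) `|v t|)%R; split; first exact: num_real.
move=> M KM w _ /=; apply: le_trans (ltW KM).
have st : size (initial w n) == n by rewrite size_initial.
rewrite (Hv (Tuple st))// (bigD1 (Tuple st))//= lerDl.
by apply: sumr_ge0.
Qed.

(** At time [n] the largest index [j < n] with depth [m j <= n] is used. Every index becomes
    eligible eventually, so the indices used tend to infinity. *)
Lemma exists_nmeasurable_repetition (h : nat -> sample_path X -> R) (c : R) :
  (forall k, finitary (fun w => (h k w)%:E)) ->
  exists h' : nat -> sample_path X -> R,
    [/\ forall n, nmeasurable n (fun w => (h' n w)%:E),
        forall n, h' n = (fun=> c) \/ exists k, h' n = h k &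
        forall K, exists N, forall n, (N <= n)%N -> exists2 k, (K <= k)%N & h' n = h k].
Proof.
move=> /choice [m Hm].
(* [kappa n] is the chosen index plus one; the value 0 means that no index is eligible yet, and
   [h' n] is then the constant [c]. *)
have /choice [kappa Hk] : forall n, exists k, (k <= n)%N /\
    (forall j, j.+1 = k -> (m j <= n)%N) /\
    forall j, (j.+1 <= n)%N -> (m j <= n)%N -> (j.+1 <= k)%N.
  move=> n; pose P k := (k <= n)%N && (if k is j.+1 then m j <= n else true)%N.
  have [||k /andP[kn Pk] kmax] := @ex_maxnP P n; first by exists 0%N.
    by move=> k /andP[].
  exists k; split=> //; split=> [j jk|j jn mj]; first by move: Pk; rewrite -jk.
  by apply: kmax; rewrite /P jn.
pose h' n := if kappa n is k.+1 then h k else (fun=> c).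
exists h'; split.
- move=> n; rewrite /h'; have [_ [+ _]] := Hk n.
  case: (kappa n) => [_|j /(_ j erefl) mjn]; first by move=> t _ w w'.
  exact: nmeasurable_le (Hm j).
- by move=> n; rewrite /h'; case: (kappa n) => [|j]; [left|right; exists j].
- move=> K; exists (maxn K.+1 (m K)) => n; rewrite geq_max => /andP[Kn mn].
  have [_ [_ /(_ K Kn mn)]] := Hk n; rewrite /h'.
  by case: (kappa n) => // k; rewrite ltnS => Kk; exists k.
Qed.

Lemma repetition_cvg (h h' : nat -> sample_path X -> R) w (l : \bar R) :
  (forall K, exists N, forall n, (N <= n)%N -> exists2 k, (K <= k)%N & h' n = h k) ->
  (h n w)%:E @[n --> \oo] --> l -> (h' n w)%:E @[n --> \oo] --> l.
Proof.
move=> hh' /cvg_ereal_orderP [lo hi]; apply/cvg_ereal_orderP.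
split=> c cl; [have [K HK] := lo c cl|have [K HK] := hi c cl];
  have [N HN] := hh' K; exists N => n /HN [k Kk ->]; exact: HK.
Qed.

Lemma Vblim_gambles (f : sample_path X -> \bar R) (b : R) (c : \bar R) :
  (forall w, b%:E <= f w <= c) -> b%:E <= c ->
  (exists g : nat -> sample_path X -> \bar R,
    (forall n, finitary (g n)) /\ (forall w, g ^~ w @ \oo --> f w)) ->
  exists G : nat -> sample_path X -> R,
    [/\ forall n, nmeasurable n (fun w => (G n w)%:E),
        forall n w, b%:E <= (G n w)%:E <= c &
        forall w, (G n w)%:E @[n --> \oo] --> f w].
Proof.
move=> bfc bc [g [gfin gf]].
(* The cut at [n] makes the values real even if [g] or [c] is infinite; the maximum comes last, so
   that [b] is respected also when [n < b]. *)
pose clip n w := maxe b%:E (mine (mine (g n w) c) n%:R%:E).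
have clipE n w : (fine (clip n w))%:E = clip n w.
  apply: fineK; rewrite fin_numElt; apply/andP; split.
    by rewrite lt_max ltNyr.
  by rewrite gt_max ltry /= gt_min ltry orbT.
have clipfin k : finitary (fun w => (fine (clip k w))%:E).
  have [n /nmeasurableP gn] := gfin k; exists n; apply/nmeasurableP => w w' /gn gww'.
  by rewrite /clip gww'.
have [G [mG Gor Gev]] := exists_nmeasurable_repetition b clipfin.
exists G; split=> //.
  move=> n w; case: (Gor n) => [->|[k ->]]; first by rewrite lexx.
  by rewrite clipE /clip le_max lexx /= ge_max bc /= !ge_min lexx orbT.
move=> w; apply: (repetition_cvg Gev).
have /andP[bf fc] := bfc w.
have [lo hi] := (cvg_ereal_orderP _ _).1 (gf w).
under eq_fun do rewrite clipE.
apply/cvg_ereal_orderP; split=> d.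
  move=> df; have [N HN] := lo d df.
  have [N' HN'] : exists N', forall n, (N' <= n)%N -> d < (n%:R : R)%:E.
    case: d df {HN} => [d| |] df; last by exists 0%N => n _; exact: ltNyr.
      exists (Num.trunc d).+1 => n dn; rewrite lte_fin.
      by apply: lt_le_trans (truncnS_gt d) _; rewrite ler_nat.
    by rewrite ltNge leey in df.
  exists (maxn N N') => n; rewrite geq_max => /andP[Nn N'n].
  by rewrite /clip lt_max; apply/orP; right; rewrite !lt_min HN// HN'// (lt_le_trans df).
move=> fd; have [N HN] := hi d fd; exists N => n Nn.
by rewrite /clip gt_max (le_lt_trans bf fd)/= !gt_min HN.
Qed.

Variable Q : situation X -> (X -> \bar R) -> \bar R.
Hypothesis HQ : probability_tree Q.

(* Stop a nearly optimal supermartingale as soon as it dominates one of the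
   [G j], [k <= j], and take that [G j]; by compactness the stopping time is
   bounded. *)
Lemma exists_stopped_gamble (B : R) (G : nat -> sample_path X -> R)
    (f : sample_path X -> \bar R) s k (d : R) :
  (forall n, nmeasurable n (fun w => (G n w)%:E)) ->
  (forall w, B%:E <= f w) -> (forall w, (G n w)%:E @[n --> \oo] --> f w) ->
  (0 < d)%R ->
  exists fk : sample_path X -> R, [/\ finitary (fun w => (fk w)%:E),
    forall w, exists2 j, (k <= j)%N & fk w = G j w &
    global_upper Q (fun w => (fk w)%:E) s <= global_upper Q f s + d%:E].
Proof.
move=> mG Bf Gf d0.
case: (eqVneq (global_upper Q f s) +oo) => [->|Efy].
  exists (G k); split; first by exists k.
    by move=> w; exists k.
  by rewrite addye// leey.
have Efin : global_upper Q f s \is a fin_num.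
  have : B%:E <= global_upper Q f s by exact: global_upper_ge.
  by move: Efy; case: (global_upper Q f s).
have d20 : (0 < d / 2)%R by lra.
have [|M [HM BM Ms fM]] := @global_upper_lt _ _ _ HQ B f s (global_upper Q f s + (d / 2)%:E) Bf.
  by rewrite lteDl// lte_fin.
(* One half of [d] pays for the choice of [M]; the other makes the limit inferior strictly larger
   than [f] where [f] is finite. *)
pose M' t := (d / 2)%:E + M t.
have BM' t : B%:E <= M' t by rewrite /M' (le_trans (BM t))// leeDr// lee_fin ltW.
have HM' : supermartingale Q M'.
  by apply: supermartingaleD => //; apply: supermartingale_cst => //; exact: ltNyr.
have liminfM' w : liminf_along M' w = (d / 2)%:E + liminf_along M w.
  by rewrite /liminf_along limn_einf_shift.
(* Since [j <= size t], the gamble [G j] is constant on the cylinder of [t], and one path through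
   [t] decides the comparison. *)
pose wins t j := [/\ (k <= j)%N, (j <= size t)%N &
  forall w, cylinder t w -> (G j w)%:E <= M' t].
pose D t := (size s <= size t)%N && `[< exists j, wins t j >].
have Dex w : exists n, D (initial w n).
  have [j kj Gj] : exists2 j, (k <= j)%N & (G j w)%:E < liminf_along M' w.
    have lt_liminf x : x <= f w + (d / 2)%:E -> x <= liminf_along M' w.
      by move=> /le_trans; apply; rewrite liminfM' addeC leeD.
    case: (eqVneq (f w) +oo) => [fy|fny].
      exists k => //; apply: (@lt_le_trans _ _ +oo); first exact: ltry.
      by apply: lt_liminf; rewrite fy.
    have ffin : f w \is a fin_num by move: fny (Bf w); case: (f w).
    have [_ hi] := (cvg_ereal_orderP _ _).1 (Gf w).
    have [|N HN] := hi (f w + (d / 2)%:E); first by rewrite lteDl// lte_fin.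
    exists (maxn k N); first exact: leq_maxl.
    by apply: lt_le_trans (HN _ (leq_maxr _ _)) _; exact: lt_liminf.
  have [n0 Hn0] := limn_einf_gt Gj.
  pose n := maxn (size s) (maxn j n0).
  have jn : (j <= n)%N by rewrite /n !leq_max leqnn orbT.
  exists n; rewrite /D size_initial leq_maxl /=; apply/asboolP.
  exists j; split=> //; first by rewrite size_initial.
  move=> w' /cylinder_initialP w'w.
  rewrite ((nmeasurableP _ _).1 (mG j) w' w (initial_le jn w'w)).
  by apply: ltW; apply: Hn0; rewrite /n !leq_max leqnn !orbT.
have /choice [J HJ] : forall t, exists j, D t -> wins t j.
  move=> t; have [/andP[_ /asboolP [j Hj]]|nD] := boolP (D t); first by exists j.
  by exists 0%N.
have [N HN] := @konig X (fun t => D t) Dex.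
have /choice [tau Htau] : forall w, exists n, [/\ (n <= N)%N, D (initial w n) &
    forall i, (i < n)%N -> ~~ D (initial w i)].
  move=> w; case: (ex_minnP (Dex w)) => n Dn nmin; exists n; split=> //.
    by have [m mN /nmin nm] := HN w; exact: leq_trans nm mN.
  by move=> i iltn; apply/negP => /nmin; rewrite leqNgt iltn.
(* The first hitting time is a stopping time bounded by [N], hence determined by the first [N]
   states. *)
have tau_eq w w' : initial w N = initial w' N -> tau w = tau w'.
  move=> ww'; have [tN Dt tmin] := Htau w; have [tN' Dt' tmin'] := Htau w'.
  apply/eqP; rewrite eqn_leq; apply/andP; split; rewrite leqNgt; apply/negP => lt.
    by have := tmin _ lt; rewrite (initial_le tN' ww') Dt'.
  by have := tmin' _ lt; rewrite -(initial_le tN ww') Dt.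
exists (fun w => G (J (initial w (tau w))) w); split.
- exists N; apply/nmeasurableP => w w' ww'.
  have [tN Dt _] := Htau w; have [_ Jt _] := HJ _ Dt.
  rewrite -(tau_eq _ _ ww') -(initial_le tN ww').
  apply: ((nmeasurableP _ _).1 (mG _)); apply: initial_le ww'.
  by apply: leq_trans tN; rewrite size_initial in Jt.
- by move=> w; have [_ Dt _] := Htau w; have [kJ _ _] := HJ _ Dt; eexists; first exact: kJ.
(* Once stopped, [S] is frozen at a value dominating the selected gamble, so its limit inferior
   dominates it too. *)
- pose S := switch D M' (fun v _ => M' v).
  have HS : supermartingale Q S.
    apply: (@supermartingale_switch _ _ _ HQ B) => //.
    move=> v _; apply: supermartingale_cst => //.
    by apply: lt_le_trans (BM' v); exact: ltNyr.
  apply: (@le_trans _ _ (S s)).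
    apply: global_upper_le => // w _.
    have [tN Dt tmin] := Htau w; have [_ _ HG] := HJ _ Dt.
    apply: (@limn_einf_ge _ _ _ (tau w)) => n tn.
    rewrite /S (switch_hit _ _ tn)//; apply: HG.
    exact/cylinder_initialP.
  apply: (@le_trans _ _ (M' s)).
    apply: (@switch_le _ _ D M') => // i is_.
    by rewrite /D size_take is_ leqNgt is_.
  apply: (@le_trans _ _ ((d / 2)%:E + (global_upper Q f s + (d / 2)%:E))).
    by rewrite /M' leeD// ltW.
  by rewrite addeCA -EFinD -splitr.
Qed.

End Approximation.

(** * Construction of the sequence and convergence of its upper expectations *)

Theorem proposition33 (R : realType) (X : finType) (X_gt0 : (0 < #|X|)%N)
    (Q : situation X -> (X -> \bar R) -> \bar R) (HQ : probability_tree Q)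
    (s : situation X) (f : sample_path X -> \bar R) (Hf : Vblim f) :
  exists fn : nat -> sample_path X -> R,
    [/\ forall n, bounded_fun (fn n),
        forall n, nmeasurable n (fun w => (fn n w)%:E),
        exists B : R, forall n w, (B <= fn n w)%R,
        forall w, (fun n => (fn n w)%:E) @ \oo --> f w &
        [/\ (fun n => global_upper Q (fun w => (fn n w)%:E) s) @ \oo
              --> global_upper Q f s,
            forall n w, (fn n w)%:E <= ereal_sup (range f) &
            ereal_inf (range f) \is a fin_num ->
              forall n w, ereal_inf (range f) <= (fn n w)%:E]].
Proof.
have [[B0 B0f] gf] := Hf.
have [x0 _] : exists x : X, x \in X by apply/card_gt0P.
pose w0 : sample_path X := fun=> x0.
(* The infimum itself is the lower truncation level when it is real; otherwise [f] is identically
   [+oo] and any real lower bound serves. *)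
pose lo : R := if ereal_inf (range f) \is a fin_num then fine (ereal_inf (range f)) else B0.
have lof w : lo%:E <= f w.
  rewrite /lo; case: ifP => [fin|_]; last exact: B0f.
  by rewrite fineK//; apply: ereal_inf_lbound; exists w.
have fsup w : f w <= ereal_sup (range f) by apply: ereal_sup_ubound; exists w.
have [|| G [mG Gbd Gf]] := @Vblim_gambles _ _ f lo (ereal_sup (range f)) _ _ gf.
- by move=> w; rewrite lof fsup.
- exact: le_trans (lof w0) (fsup w0).
have d0 k : (0 < (k.+1%:R : R)^-1)%R by [].
have /choice [h Hh] := fun k => exists_stopped_gamble HQ s k mG lof Gf (d0 k).
have hfin k : finitary (fun w => (h k w)%:E) by have [] := Hh k.
have [fn [mfn fnor fnev]] := exists_nmeasurable_repetition lo hfin.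
have fnbd n w : lo%:E <= (fn n w)%:E <= ereal_sup (range f).
  case: (fnor n) => [->|[k ->]]; first by rewrite lexx (le_trans (lof w) (fsup w)).
  by have [_ /(_ w) [j _ ->] _] := Hh k.
have fnf w : (fn n w)%:E @[n --> \oo] --> f w.
  apply: (repetition_cvg fnev); have [lo' hi'] := (cvg_ereal_orderP _ _).1 (Gf w).
  apply/cvg_ereal_orderP; split=> c cl; [have [K HK] := lo' c cl|have [K HK] := hi' c cl];
    exists K => n Kn; have [_ /(_ w) [j nj ->] _] := Hh n; apply: HK; exact: leq_trans nj.
exists fn; split=> //.
- by move=> n; exact: bounded_nmeasurable (mfn n).
- by exists lo => n w; have /andP[] := fnbd n w.
split.
- apply/cvg_ereal_orderP; split=> c.
    (* The lower half of the convergence is Fatou's lemma, as [f] is the limit inferior of the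
       [fn]. *)
    move=> cE; apply: limn_einf_gt; apply: (lt_le_trans cE).
    apply: (@global_upper_fatou _ _ _ HQ lo); first by move=> n w; have /andP[] := fnbd n w.
    by move=> w; have [-> _] := cvg_limn_einf_sup (fnf w).
  (* The upper half comes from the stopping bound: from some time on only [h k] with [k >= K] occur,
     with error at most [1 / (K + 1)]. *)
  move=> Ec; have loE : lo%:E <= global_upper Q f s by exact: global_upper_ge.
  have [e Ee] : exists e, global_upper Q f s = e%:E.
    by move: loE Ec; case: (global_upper Q f s) => [e _ _|_|//]; [exists e|rewrite ltNge leey].
  have [K HK] : exists K, e%:E + ((K.+1%:R : R)^-1)%:E < c.
    move: Ec; rewrite Ee; case: c => [c| |]// ec; last by exists 0%N; rewrite -EFinD ltry.
    by have [K HK] := ltr_add_invr ec; exists K; rewrite -EFinD lte_fin.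
  have [N HN] := fnev K; exists N => n /HN [k Kk ->].
  have [_ _ hE] := Hh k; apply: (le_lt_trans hE); apply: le_lt_trans HK.
  by rewrite Ee leeD// lee_fin lef_pV2 ?posrE// ler_nat.
- by move=> n w; have /andP[] := fnbd n w.
- move=> fin n w; have /andP[+ _] := fnbd n w.
  by rewrite /lo fin fineK.
Qed.
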